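(* Let $\mathbb{F}$ be a finite field, let $V$ be a finite-dimensional vector space over $\mathbb{F}$, let $d \ge 1$, and let $T_1, \ldots, T_m, S_1, \ldots, S_n : V^d \to \mathbb{F}$ be order-$d$ tensors. Then $$\Pr_{\mathbf{x} \in V^d}[T_1(\mathbf{x}) = \cdots = T_m(\mathbf{x}) = S_1(\mathbf{x}) = \cdots = S_n(\mathbf{x}) = 0] \ \ge\ \Pr_{\mathbf{x} \in V^d}[T_1(\mathbf{x}) = \cdots = T_m(\mathbf{x}) = 0] \cdot \Pr_{\mathbf{x} \in V^d}[S_1(\mathbf{x}) = \cdots = S_n(\mathbf{x}) = 0].$$
   Context: An order-$d$ tensor is a multilinear map $T : V^d \to \mathbb{F}$ (linear in each of its $d$ arguments separately). Probabilities are over $\mathbf{x} = (x^1,\ldots,x^d)$ chosen uniformly at random from the finite set $V^d$. *)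

(* Defs.v *)
From HB Require Import structures.
From mathcomp Require Import all_boot all_order all_algebra all_field.

Set Implicit Arguments.
Unset Strict Implicit.
Unset Printing Implicit Defensive.

Import Order.TTheory GRing.Theory Num.Theory.

Local Open Scope ring_scope.

(* [dfwith x v] is [x] with its [i]-th argument replaced by [v : V]. *)
Definition is_tensor (F : fieldType) (V : lmodType F) (d : nat)
    (T : {ffun 'I_d -> V} -> F) : Prop :=
  forall (i : 'I_d) (x : {ffun 'I_d -> V}),
    scalar (fun v : V => T (finfun (dfwith x (i := i) v))).

Definition Pr (Omega : finType) (E : {set Omega}) : rat :=
  #|E|%:R / #|Omega|%:R.

(* [finvect_type V] is [V] itself, made a [finType] when the scalar field is
   finite; so tensors on [V] apply to the points of this sample space. *)
Definition points (F : finFieldType) (V : vectType F) (d : nat) : finType :=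
  {ffun 'I_d -> finvect_type V}.

(* Main.v *)
(** Sampling [x] and [y] independently, replace the coordinates of [y] by those of
    [x] one at a time.  With all other coordinates frozen, the events "[x] is a
    common zero of the [T i]" and "the hybrid is a common zero of the [S j]" become
    subgroups [K] and [L] of [V], and [|K| |L| <= |V| |K :&: L|]; so each replacement
    can only increase the probability of the joint event. *)
Require Import Defs.
From HB Require Import structures.
From mathcomp Require Import all_boot all_order all_algebra all_field.
From mathcomp Require Import all_fingroup.

Set Implicit Arguments.
Unset Strict Implicit.
Unset Printing Implicit Defensive.

Import Order.TTheory GRing.Theory Num.Theory.

Local Open Scope ring_scope.

Section SlicewiseSubgroups.

Local Open Scope nat_scope.

Variables (I : finType) (G : finGroupType).
Implicit Types (x y : {ffun I -> G}) (A B : {set {ffun I -> G}}) (D : {set I}).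

Definition upd x (i : I) (v : G) : {ffun I -> G} := finfun (dfwith x (i := i) v).

Definition mix D x y : {ffun I -> G} := [ffun j => if j \in D then x j else y j].

Definition slicewise_group A :=
  forall i x, group_set [set v | upd x i v \in A].

Lemma updE x i v j : upd x i v j = if j == i then v else x j.
Proof.
rewrite ffunE; case: eqVneq => [->|ne]; first exact: dfwith_in.
by rewrite dfwith_out // eq_sym.
Qed.

Lemma mix_upd_in D x y i u v :
  mix (i |: D) (upd x i u) (upd y i v) = upd (mix (i |: D) x y) i u.
Proof.
by apply/ffunP=> j; rewrite !(ffunE, updE) !inE; case: eqVneq.
Qed.

Lemma mix_upd_out D x y i u v : i \notin D ->
  mix D (upd x i u) (upd y i v) = upd (mix D x y) i v.
Proof.
move=> iD; apply/ffunP=> j; rewrite !(ffunE, updE).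
by case: eqVneq => [->|//]; rewrite (negPf iD).
Qed.

Lemma upd_mixU1 D x y i u : upd (mix (i |: D) x y) i u = upd (mix D x y) i u.
Proof.
by apply/ffunP=> j; rewrite !(ffunE, updE) !inE; case: eqVneq.
Qed.

(** Swapping [v] with the [i]-th coordinate of [x] is an involution on the pairs [(x, v)], so
    resampling one coordinate preserves the uniform distribution. *)
Lemma sum_upd (f : {ffun I -> G} -> nat) i :
  \sum_x \sum_v f (upd x i v) = #|G| * \sum_x f x.
Proof.
pose h (p : {ffun I -> G} * G) := (upd p.1 i p.2, p.1 i).
have hK : involutive h.
  case=> x v; rewrite /h /= updE eqxx; congr pair.
  by apply/ffunP=> j; rewrite !updE; case: eqVneq => [->|].
rewrite pair_big /= -(pair_big xpredT xpredT (fun x v => f (upd x i v))) /=.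
rewrite pair_big /= (reindex_inj (inv_inj hK)) /=.
(* After reindexing by [h], the summand is [f (h (h p)).1], which the involution collapses. *)
rewrite (eq_bigr (fun p => f p.1)) => [|p _]; last by rewrite -/(h p).1 -[in RHS](hK p).
rewrite -(pair_big xpredT xpredT (fun x (v : G) => f x)) /= big_distrr /=.
by apply: eq_bigr => x _; rewrite sum_nat_const.
Qed.

(** The product formula gives |K| |L| = |KL| |K :&: L|, and KL lies in [G]. *)
Lemma leq_mul_card_setI (K L : {set G}) : group_set K -> group_set L ->
  #|K| * #|L| <= #|G| * #|K :&: L|.
Proof.
move=> gK gL; have := mul_cardG (Group gK) (Group gL) => /= ->.
by rewrite leq_mul2r max_card orbT.
Qed.

(** The joint probability scaled by the number of pairs [(x, y)], which keeps the argument in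
    [nat]. *)
Definition hybrid A B D := \sum_x \sum_y ((x \in A) * (mix D x y \in B)).

(** Resampling coordinate [i] of [x] and of [y] independently isolates the slices in direction [i]
    as inner sums over [u] and [v]. *)
Lemma hybrid_upd A B D i :
  #|G| * (#|G| * hybrid A B D) =
  \sum_x \sum_y \sum_u \sum_v
    ((upd x i u \in A) * (mix D (upd x i u) (upd y i v) \in B)).
Proof.
pose f x y : nat := (x \in A) * (mix D x y \in B).
rewrite -(sum_upd (fun x => \sum_y f x y) i) big_distrr.
apply: eq_bigr => x _; rewrite [RHS]exchange_big big_distrr.
by apply: eq_bigr => u _ /=; rewrite -(sum_upd (f (upd x i u)) i).
Qed.

(** The comparison holds for each fixed [x] and [y]. With [D], the two events constrain [u] and [v]
    separately, giving |K| |L|; with [i |: D], both constrain [u] and [v] is free, giving |G| |K :&: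
    L|. *)
Lemma hybrid_U1 A B D i : slicewise_group A -> slicewise_group B -> i \notin D ->
  hybrid A B D <= hybrid A B (i |: D).
Proof.
move=> gA gB iD; have G0 : 0 < #|G| by apply/card_gt0P; exists 1%g.
rewrite -(leq_pmul2l G0) -(leq_pmul2l G0) !(hybrid_upd _ _ _ i).
apply: leq_sum => x _; apply: leq_sum => y _.
have cardE (C : {set G}) : #|C| = \sum_u (u \in C) by rewrite -sum1_card big_mkcond.
(* The same slice of [B] serves both sides, since [mix D x y] and [mix (i |: D) x y] differ at most
   at [i]. *)
have := leq_mul_card_setI (gA i x) (gB i (mix D x y)).
set K := [set _ | _]; set L := [set _ | _] => KL.
rewrite [leqLHS](_ : _ = #|K| * #|L|); last first.
  rewrite !cardE big_distrl; apply: eq_bigr => u _; rewrite big_distrr.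
  by apply: eq_bigr => v _; rewrite mix_upd_out // !inE.
rewrite [leqRHS](_ : _ = #|G| * #|K :&: L|) // cardE big_distrr.
apply: eq_bigr => u _ /=; rewrite -sum_nat_const; apply: eq_bigr => v _.
by rewrite mix_upd_in upd_mixU1 !inE mulnb.
Qed.

Lemma hybrid0_le A B D : slicewise_group A -> slicewise_group B ->
  hybrid A B set0 <= hybrid A B D.
Proof.
move=> gA gB; have [k] := ubnP #|D|; elim: k D => // k IHk D leDk.
have [->//|[i iD]] := set_0Vmem D.
rewrite -(setD1K iD) (leq_trans (IHk (D :\ i) _)) ?hybrid_U1 ?setD11 //.
by move: leDk; rewrite (cardsD1 i) iD.
Qed.

(** The two extreme hybrids are compared: at [set0] the events concern independent points, at [setT]
    both concern [x] and [y] is free. *)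
Lemma card_slicewise_setI A B : slicewise_group A -> slicewise_group B ->
  #|A| * #|B| <= #|{ffun I -> G}| * #|A :&: B|.
Proof.
move=> gA gB; have := hybrid0_le setT gA gB.
have cardE (C : {set {ffun I -> G}}) : #|C| = \sum_x (x \in C).
  by rewrite -sum1_card big_mkcond.
have mix0 x y : mix set0 x y = y by apply/ffunP=> j; rewrite ffunE inE.
have mixT x y : mix setT x y = x by apply/ffunP=> j; rewrite ffunE inE.
rewrite [leqLHS](_ : _ = #|A| * #|B|); last first.
  rewrite !cardE big_distrl; apply: eq_bigr => x _; rewrite big_distrr.
  by apply: eq_bigr => y _; rewrite mix0.
rewrite [leqRHS](_ : _ = #|{ffun I -> G}| * #|A :&: B|) // cardE big_distrr.
apply: eq_bigr => x _ /=; rewrite -sum_nat_const; apply: eq_bigr => y _.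
by rewrite mixT inE mulnb.
Qed.

End SlicewiseSubgroups.

Lemma slicewise_group_zeros (F : finFieldType) (V : vectType F) (d m : nat)
    (T : 'I_m -> {ffun 'I_d -> V} -> F) (hT : forall i, is_tensor (T i)) :
  @slicewise_group 'I_d (finvect_type V : finZmodType) [set x : points V d | [forall i, T i x == 0]].
Proof.
move=> k x; apply/group_setP; split=> [|u v].
  (* Linearity at [-1 *: 0 + 0] makes the tensor vanish when its [k]-th argument is 0. Since the
     group is finite, closure under addition is then all that remains. *)
  rewrite !inE; apply/forallP=> i; have := hT i k x (-1) 0 0.
  by rewrite scaler0 addr0 mulN1r addNr => /eqP.
rewrite !inE => /forallP Tu /forallP Tv; apply/forallP=> i.
have := hT i k x 1 u v.
rewrite scale1r mul1r => e; apply/eqP; apply: etrans e _.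
by rewrite (eqP (Tu i)) (eqP (Tv i)) addr0.
Qed.

Theorem claim1p6 (F : finFieldType) (V : vectType F) (d : nat) (hd : (0 < d)%N)
    (m n : nat)
    (T : 'I_m -> {ffun 'I_d -> V} -> F) (S : 'I_n -> {ffun 'I_d -> V} -> F)
    (hT : forall i, is_tensor (T i)) (hS : forall j, is_tensor (S j)) :
  Pr [set x : points V d | [forall i, T i x == 0] && [forall j, S j x == 0]]
  >= Pr [set x : points V d | [forall i, T i x == 0]]
     * Pr [set x : points V d | [forall j, S j x == 0]].
Proof.
have := card_slicewise_setI (slicewise_group_zeros hT) (slicewise_group_zeros hS).
rewrite -setIdE /Pr.
rewrite (_ : [set x in _ | _] = [set x : points V d |
   [forall i, T i x == 0] && [forall j, S j x == 0]]); last first.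
  by apply/setP=> x; rewrite !inE.
move=> le_card.
have N0 : 0 < #|points V d|%:R :> rat.
  by rewrite ltr0n; apply/card_gt0P; exists [ffun=> 0].
rewrite mulf_div ler_pdivrMr ?mulr_gt0 // mulrA divfK ?gt_eqF //.
by rewrite -!natrM ler_nat [leqRHS]mulnC.
Qed.
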